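(* Let $k$ and $\Delta$ be integers with $k\ge 3$ and $\Delta=2$ or $\Delta \ge 4$, and let $G$ be a graph of order $n$ and of maximum degree at most $\Delta$. Then the following hold. \begin{itemize} \item[$(i)$] If $\Delta\geq 2$ is even, then $$\psi_k(G)\le \frac{(k-1)(\Delta-2)+4}{(k-1)\Delta+4}\,n.$$ \item[$(ii)$] If $\Delta\geq 5$ is odd, then $$\psi_k(G)\le \frac{(k-1)(\Delta-3)+8}{(k-1)(\Delta-1)+8}\,n.$$ \end{itemize}
   Context: Graphs are finite, simple and undirected. The order of $G$ is $n=|V(G)|$. $P_k$ denotes the path with $k$ vertices. A $k$-path vertex cover of $G$ is a set $T\subseteq V(G)$ such that $G-T$ contains no (not necessarily induced) subgraph isomorphic to $P_k$. $\psi_k(G)$ is the minimum cardinality of a $k$-path vertex cover of $G$. *)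

(* Defs.v *)
From mathcomp Require Import all_boot.

Set Implicit Arguments.
Unset Strict Implicit.
Unset Printing Implicit Defensive.

Record sgraph := SGraph {
  svertex :> finType;
  sedge : rel svertex;
  sedge_sym : symmetric sedge;
  sedge_irrefl : irreflexive sedge
}.

Definition degree (G : sgraph) (x : G) : nat := #|[set y | sedge x y]|.

Definition max_degree (G : sgraph) : nat := \max_(x : G) degree x.

Section PathGraph.
Variable k : nat.

Definition path_edge (i j : 'I_k) : bool :=
  (i.+1 == j :> nat) || (j.+1 == i :> nat).

Lemma path_edge_sym : symmetric path_edge.
Proof. by move=> i j; rewrite /path_edge orbC. Qed.

Lemma path_edge_irrefl : irreflexive path_edge.
Proof. by move=> i; rewrite /path_edge orbb gtn_eqF. Qed.

Definition path_graph : sgraph := SGraph path_edge_sym path_edge_irrefl.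
End PathGraph.

Section DeleteVertices.
Variables (G : sgraph) (T : {set G}).

Definition del_edge (x y : {x : G | x \notin T}) : bool :=
  sedge (val x) (val y).

Lemma del_edge_sym : symmetric del_edge.
Proof. by move=> x y; apply: sedge_sym. Qed.

Lemma del_edge_irrefl : irreflexive del_edge.
Proof. by move=> x; apply: sedge_irrefl. Qed.

Definition del_vertices : sgraph := SGraph del_edge_sym del_edge_irrefl.
End DeleteVertices.

(* [G] has a (not necessarily induced) subgraph isomorphic to [H]: an
   injective map of vertices sending edges to edges; non-edges of [H] are
   unconstrained. *)
Definition has_subgraph (H G : sgraph) : bool :=
  [exists f : {ffun H -> G}, injectiveb f &&
    [forall x, forall y, sedge x y ==> sedge (f x) (f y)]].

Definition path_vertex_cover (k : nat) (G : sgraph) (T : {set G}) : bool :=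
  ~~ has_subgraph (path_graph k) (del_vertices T).

(* The default [setT] of the arg min is a cover whenever [k > 0] (see
   [path_vertex_coverT]), so [psi] is then the genuine minimum
   (see [psi_min]); for [k = 0] there is no cover and the value is
   meaningless. *)
Definition psi (k : nat) (G : sgraph) : nat :=
  #|[arg min_(T < [set: G] | path_vertex_cover k T) #|T|]|.

Lemma path_vertex_coverT (k : nat) (G : sgraph) :
  0 < k -> path_vertex_cover k [set: G].
Proof.
case: k => // k _; apply/negP => /existsP[f _].
by have := valP (f ord0); rewrite inE.
Qed.

Lemma psi_min (k : nat) (G : sgraph) : 0 < k ->
  (exists2 T : {set G}, path_vertex_cover k T & #|T| = psi k G) /\
  (forall T : {set G}, path_vertex_cover k T -> psi k G <= #|T|).
Proof.
move=> k_gt0; rewrite /psi.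
case: arg_minnP => [|T covT minT]; first exact: path_vertex_coverT.
by split=> //; exists T.
Qed.

(* Main.v *)
Require Import Defs.
From HB Require Import structures.
From mathcomp Require Import all_boot all_order all_algebra.
From mathcomp Require Import zify ring lra.

Import Order.TTheory GRing.Theory Num.Theory.

Set Implicit Arguments.
Unset Strict Implicit.
Unset Printing Implicit Defensive.

(** The complement of a minimum [k]-path vertex cover is a largest vertex set
    inducing a graph without [P_k]; let [M = n - psi k G] be its size.  An upper
    bound on [psi k G] is the same as a lower bound on [M], and this comes from
    splitting the graph into few classes each of which is almost [P_k]-free.

    A theorem of Lovász ([lovasz_decomposition]) splits the vertices into
    classes inducing graphs of maximum degree at most [t_1, ..., t_d], as soon
    as the maximum degree is less than the sum of the [t_i + 1].  The prescribed
    degrees here are [2] for [r] classes and [1] for the remaining [d - r], so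
    that maximum degree less than [2 d + r] suffices.

    A class of degree at most [1] has no path on three vertices, hence has at
    most [M] vertices.  In a class of degree at most [2] every component is a
    path or a cycle; deleting every [k]-th vertex along the components with at
    least [k] vertices keeps a fraction at least [(k-1)/(k+1)] of the class
    ([degree2_path_free]), the worst case being the cycle on [k + 1] vertices,
    where two vertices are deleted.  Hence such a class has at most
    [M (k+1)/(k-1)] vertices.  Adding up,
      [(k-1) n <= ((d - r) (k-1) + r (k+1)) M = (d (k-1) + 2 r) M],
    which is [path_free_bound].  The two parts of the theorem are the cases
    [Delta = 2 d], [r = 1] and [Delta = 2 d + 1], [r = 2]; as
    [r <= d], the latter needs [Delta >= 5]. *)

(** * Lovász's decomposition *)

Definition degree_in (G : sgraph) (A : {set G}) (x : G) : nat :=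
  #|[set y in A | sedge x y]|.

Section Lovasz.
Variables (G : sgraph) (I : finType).
Implicit Types (c : {ffun G -> I}) (x y v : G) (i j : I).

Definition color_class c i : {set G} := [set x | c x == i].

(** Every monochromatic edge is counted twice, once for each ordering of its
    ends. *)
Definition mono_pairs c : nat := \sum_x \sum_y (sedge x y && (c x == c y)).

Definition recolor c v j : {ffun G -> I} :=
  [ffun x => if x == v then j else c x].

Lemma degree_in_class c v i :
  degree_in (color_class c i) v = \sum_(y | y != v) (sedge v y && (c y == i)).
Proof.
rewrite /degree_in -sum1_card big_mkcond [RHS]big_mkcond.
apply: eq_bigr => y _; rewrite !inE.
have [->|_] /= := eqVneq y v; first by rewrite sedge_irrefl andbF.
by rewrite andbC; case: (_ && _).
Qed.

(** Isolates what depends on the color of [v]: the double sum over the other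
    vertices is unaffected by recoloring [v]. *)
Lemma mono_pairs_split c v :
  mono_pairs c = 2 * degree_in (color_class c (c v)) v
    + \sum_(x | x != v) \sum_(y | y != v) (sedge x y && (c x == c y)).
Proof.
rewrite /mono_pairs (bigD1 v) //= (bigD1 v) //= sedge_irrefl add0n.
under [X in _ + X = _]eq_bigr do rewrite (bigD1 v) //=.
rewrite big_split /= addnA; congr (_ + _).
rewrite degree_in_class mul2n -addnn; congr (_ + _); apply: eq_bigr => y _.
  by rewrite [c v == _]eq_sym.
by rewrite sedge_sym.
Qed.

Lemma degree_in_recolor c v j i :
  degree_in (color_class (recolor c v j) i) v = degree_in (color_class c i) v.
Proof.
rewrite !degree_in_class; apply: eq_bigr => y /negbTE ne_yv.
by rewrite ffunE ne_yv.
Qed.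

Lemma sum_degree_in c v : \sum_i degree_in (color_class c i) v = degree v.
Proof.
rewrite /degree -sum1_card (partition_big c xpredT) //=.
apply: eq_bigr => i _; rewrite /degree_in -sum1_card.
by apply: eq_bigl => y; rewrite !inE andbC.
Qed.

(** Take a coloring minimizing the number of monochromatic edges minus the sum
    over the vertices of the prescribed degree of their color.  If [v] has too
    many neighbors of its own color, then, its degree being less than the sum of
    the [t j + 1], some color [j] occurs at most [t j] times around it, and
    recoloring [v] with [j] decreases that quantity. *)
Lemma lovasz_decomposition (t : I -> nat) :
  max_degree G < \sum_i (t i).+1 ->
  exists c, forall x, degree_in (color_class c (c x)) x <= t (c x).
Proof.
move=> ltD; pose B := \sum_i t i.
have t_leB i : t i <= B by rewrite /B (bigD1 i) //= leq_addr.
have [i0 _|I0] := pickP I; last by move: ltD; rewrite big_pred0.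
(* Twice the quantity to be minimized, shifted by a constant to lie in nat. *)
pose Phi c := mono_pairs c + 2 * \sum_x (B - t (c x)).
have [c _ minc] := @arg_minnP _ [ffun=> i0] xpredT Phi isT.
exists c => v; rewrite leqNgt; apply/negP => lt_t.
have [j le_j] : exists j, degree_in (color_class c j) v <= t j.
  apply/existsP; rewrite -[[exists _, _]]negbK negb_exists.
  apply/negP => /forallP gt_t.
  have : \sum_i (t i).+1 <= degree v.
    by rewrite -(sum_degree_in c); apply: leq_sum => i _; rewrite ltnNge.
  have : degree v <= max_degree G by rewrite /max_degree (bigD1 v) //= leq_maxl.
  lia.
have := minc (recolor c v j) isT.
rewrite /Phi (mono_pairs_split c v) (mono_pairs_split (recolor c v j) v).
rewrite degree_in_recolor.
have recolor_v : recolor c v j v = j by rewrite ffunE eqxx.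
rewrite recolor_v !(bigD1 v (P := xpredT)) //= recolor_v.
set R := (X in _ * _ + X + _ <= _); set R' := (X in _ <= _ + X + _).
set Q := (X in _ + 2 * (_ + X) <= _); set Q' := (X in _ <= _ + 2 * (_ + X)).
have -> : R = R'.
  apply: eq_bigr => x /negbTE nx; apply: eq_bigr => y /negbTE ny.
  by rewrite !ffunE nx ny.
have -> : Q = Q' by apply: eq_bigr => x /negbTE nx; rewrite ffunE nx.
have := t_leB j; have := t_leB (c v); lia.
Qed.

End Lovasz.

(** * Vertex sets without long paths *)

Section PathFree.
Variables (G : sgraph) (k : nat).
Implicit Types (S V A : {set G}) (p s : seq G).

(** The paths of the subgraph induced by [V], as vertex sequences; the empty
    sequence is one of them. *)
Definition path_in V p : bool :=
  [&& uniq p, sorted (@sedge G) p & all (mem V) p].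

(** Bounding the length of all paths, rather than excluding paths on exactly
    [k] vertices, is equivalent (a path can be truncated) and spares the
    truncation. *)
Definition path_free S : Prop := forall p, path_in S p -> size p < k.

Lemma sorted_enum_ord n : sorted (@path_edge n) (enum 'I_n).
Proof.
have sub : subrel (relpre val (fun i j : nat => i.+1 == j)) (@path_edge n).
  by move=> i j /= eq_ij; rewrite /path_edge eq_ij.
apply: (sub_sorted sub); rewrite -sorted_map val_enum_ord.
by case: n {sub} => //= n; elim: n 0 => //= n IHn m; rewrite eqxx IHn.
Qed.

Lemma psi_path_free S : 0 < k -> path_free S -> psi k G <= #|G| - #|S|.
Proof.
move=> k_gt0 freeS; rewrite -[S]setCK -cardsCs.
apply: (psi_min G k_gt0).2; apply/negP => /existsP[f /andP[/injectiveP injf]].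
move=> /forallP edgef; pose g i := val (f i).
suff /freeS : path_in S [seq g i | i <- enum 'I_k].
  by rewrite size_map size_enum_ord ltnn.
apply/and3P; split.
- by rewrite map_inj_uniq ?enum_uniq // => i j /val_inj /injf.
- rewrite sorted_map; apply: sub_sorted (sorted_enum_ord k) => i j eij.
  by have /forallP/(_ j)/implyP/(_ eij) := edgef i.
- by apply/allP => _ /mapP[i _ ->]; have := valP (f i); rewrite !inE negbK.
Qed.

(** Connectedness of paths, in the form used below: a path cannot leave a set
    that is closed under adjacency. *)
Lemma path_in_closed S (a : pred G) x p :
  {in S &, forall y z, sedge y z -> a y -> a z} ->
  path_in S (x :: p) -> a x -> all a (x :: p).
Proof.
move=> cl /and3P[_ /= pth /andP[Sx Sp]] ax; rewrite ax /=.
elim: p x pth Sx Sp ax => //= y p IHp x /andP[exy pth] Sx /andP[Sy Sp] ax.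
have ay := cl _ _ Sx Sy exy ax.
by rewrite ay (IHp y).
Qed.

Lemma path_freeU A S :
  {in A & S, forall x y, ~~ sedge x y} ->
  path_free A -> path_free S -> path_free (A :|: S).
Proof.
move=> noedge freeA freeS [|x p]; first by move=> _; apply: (freeA [::]).
move=> pth; have /and3P[up ep] := pth.
rewrite /= inE => /andP[/orP[Ax|Sx] _].
  apply: (freeA (x :: p)); apply/and3P; split=> //.
  apply: (path_in_closed _ pth) => // y z _; rewrite inE => + eyz Ay.
  by case/orP => // Sz; have := noedge _ _ Ay Sz; rewrite eyz.
apply: (freeS (x :: p)); apply/and3P; split=> //.
apply: (path_in_closed _ pth) => // y z _; rewrite inE => + eyz Sy.
by case/orP => // Az; have := noedge _ _ Az Sy; rewrite sedge_sym eyz.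
Qed.

Lemma path_free_degree1 V :
  2 < k -> {in V, forall x, degree_in V x <= 1} -> path_free V.
Proof.
move=> k_gt2 degV [|x [|y [|z p]]] /=; try by lia.
case/and3P => /and3P[]; rewrite !inE !negb_or => /and3P[_ ne_xz _] _ _.
case/and3P => exy eyz _ /and4P[Vx Vy Vz _].
have : [set x; z] \subset [set w in V | sedge y w].
  apply/subsetP => w /set2P[]->; rewrite inE; apply/andP; split=> //.
  by rewrite sedge_sym.
move/subset_leq_card; rewrite cards2 ne_xz => le2.
by have := leq_trans le2 (degV y Vy).
Qed.

End PathFree.

(** * Classes of degree at most two *)

Section DegreeTwo.
Variables (G : sgraph) (k : nat).
Implicit Types (S V : {set G}) (s : seq G).

(** The left factor [(m.-1 %/ k).+1] is the number of multiples of [k] below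
    [m]: this is the count of vertices deleted from a component of order [m].
    With [c = m.-1 %/ k >= 1] the inequality follows from
    [(c - 1) (k - 1) >= 0]; for [c = 0] it holds since then [m = k]. *)
Lemma multiples_bound m :
  1 < k -> k <= m -> k.+1 * (m.-1 %/ k).+1 <= 2 * m.
Proof.
move=> k_gt1 le_k; have := divn_eq m.-1 k.
case: (m.-1 %/ k) => [|c]; first by lia.
case: k k_gt1 le_k => [|[|l]] // _ le_l; nia.
Qed.

Lemma longest_path V :
  exists2 s, path_in V s & forall q, path_in V q -> size q <= size s.
Proof.
pose P m := [exists t : m.-tuple G, path_in V t].
have inP q : path_in V q -> P (size q).
  by move=> qP; apply/existsP; exists (in_tuple q).
have exP : exists m, P m by exists 0; apply: (inP [::]).
have ubP m : P m -> m <= #|G|.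
  case/existsP => t /and3P[ut _ _].
  by rewrite -(size_tuple t) -(card_uniqP ut) max_card.
case: (ex_maxnP exP ubP) => m /existsP[t tP] maxm.
by exists t => // q /inP /maxm; rewrite size_tuple.
Qed.

(** In a set of induced degree at most [2], a longest path covers a whole
    component. *)
Section LongestPath.
Variables (V : {set G}) (s : seq G).
Hypothesis degV : {in V, forall x, degree_in V x <= 2}.
Hypothesis s_path : path_in V s.
Hypothesis s_longest : forall q, path_in V q -> size q <= size s.

Let mem_V x : x \in s -> x \in V.
Proof. by case/and3P: s_path => _ _ /allP; apply. Qed.

(** The two neighbors of an inner vertex along the path already exhaust its
    degree. *)
Lemma inner_neighbor y z : y \in s -> z \in V -> sedge y z ->
  0 < index y s -> (index y s).+1 < size s ->
  z \in s /\ ((index y s).+1 == index z s) || ((index z s).+1 == index y s).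
Proof.
move=> sy Vz eyz; have /and3P[us es _] := s_path.
set i := index y s => i_gt0 lt_i.
have yE : nth y s i = y by rewrite nth_index.
have e_nth j : j.+1 < size s -> sedge (nth y s j) (nth y s j.+1).
  by move/sortedP: es; apply.
have lt_i1 : i.-1 < size s by lia.
have ne : nth y s i.-1 != nth y s i.+1 by rewrite nth_uniq //; lia.
have in_nth j : j < size s -> nth y s j \in s by move=> ?; apply: mem_nth.
have sub : [set nth y s i.-1; nth y s i.+1] \subset [set w in V | sedge y w].
  apply/subsetP => w /set2P[]->; rewrite inE mem_V ?in_nth //=.
    by have := e_nth i.-1; rewrite prednK // yE sedge_sym; apply; apply: ltnW.
  by have := e_nth i lt_i; rewrite yE.
have : z \in [set nth y s i.-1; nth y s i.+1].
  have /eqP-> : [set nth y s i.-1; nth y s i.+1] == [set w in V | sedge y w].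
    by rewrite eqEcard sub cards2 ne degV ?mem_V.
  by rewrite inE Vz.
case/set2P => ->; rewrite in_nth // index_uniq // ?prednK //.
  by rewrite eqxx orbT.
by rewrite eqxx.
Qed.

(** Besides the edges of the path, the component may contain the edge joining
    its two ends, when it is a cycle.  As the first vertex gets deleted, it
    suffices to know that any other edge involves the vertex of index [0].  A
    neighbor of an end lies on the path because the path cannot be extended. *)
Lemma longest_path_neighbor y z : y \in s -> z \in V -> sedge y z ->
  z \in s /\ [|| index y s == 0, index z s == 0,
                 (index y s).+1 == index z s | (index z s).+1 == index y s].
Proof.
move=> sy Vz eyz; have /and3P[us es Vs] := s_path.
have lt_y : index y s < size s by rewrite index_mem.
have sz : z \in s.
  apply: contraT => nsz.
  have [y0|y_gt0] := posnP (index y s).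
    suff /s_longest : path_in V (z :: s) by rewrite ltnn.
    apply/and3P; split; [by rewrite /= nsz | | exact/andP].
    case: s sy es y0 => //= x p _ ->; have [-> _|//] := eqVneq x y.
    by rewrite sedge_sym eyz.
  have [last_y|lt_y1] := leqP (size s) (index y s).+1.
    suff /s_longest : path_in V (rcons s z) by rewrite size_rcons ltnn.
    apply/and3P; split; [by rewrite rcons_uniq nsz | |]; last first.
      by rewrite all_rcons; apply/andP.
    have yE : nth y s (size s).-1 = y.
      by have -> : (size s).-1 = index y s; [lia | exact: nth_index].
    move: yE; rewrite nth_last; case: s sy es => //= x p _ pth lastE.
    by rewrite rcons_path pth lastE.
  by have [] := inner_neighbor sy Vz eyz y_gt0 lt_y1; rewrite (negPf nsz).
split=> //; have lt_z : index z s < size s by rewrite index_mem.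
have [y0|y_gt0] := posnP (index y s); first by rewrite y0.
have [z0|z_gt0] := posnP (index z s); first by rewrite z0 orbT.
have [last_y|lt_y1] := leqP (size s) (index y s).+1; last first.
  by have [_ ->] := inner_neighbor sy Vz eyz y_gt0 lt_y1; rewrite !orbT.
have [last_z|lt_z1] := leqP (size s) (index z s).+1; last first.
  have ezy : sedge z y by rewrite sedge_sym.
  have [_] := inner_neighbor sz (mem_V sy) ezy z_gt0 lt_z1.
  by rewrite orbC => ->; rewrite !orbT.
have eq_yz : y = z.
  by rewrite -(nth_index y sy) -[RHS](nth_index y sz); congr nth; lia.
by move: eyz; rewrite eq_yz sedge_irrefl.
Qed.

(** Deleting index [0] together with the other multiples of [k] breaks a
    possible cycle. *)
Definition block_kept : {set G} := [set x in s | ~~ (k %| index x s)].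

(** Adjacent kept vertices have consecutive indices, neither of which is a
    multiple of [k], so the quotient of the index by [k] is constant along a
    path of kept vertices.  Only [k - 1] kept indices share a quotient. *)
Lemma path_free_block_kept : 0 < k -> path_free k block_kept.
Proof.
move=> k_gt0 [|x p] // pth; have /and3P[up _ Sp] := pth.
pose q := index x s %/ k.
have blk : {in x :: p, forall y, index y s %/ k = q}.
  move=> y py; apply/eqP; move: y py; apply/allP.
  apply: (path_in_closed (a := fun y => index y s %/ k == q) _ pth) => //= y z.
  rewrite !inE => /andP[sy ky] /andP[sz kz] eyz /eqP <-.
  have [_] := longest_path_neighbor sy (mem_V sz) eyz.
  case/or4P => /eqP eq_i; move: ky kz.
  - by rewrite eq_i dvdn0.
  - by rewrite eq_i dvdn0.
  - by rewrite -eq_i => _ kz; rewrite divnS // (negPf kz).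
  - by rewrite -eq_i => kz _; rewrite divnS // (negPf kz).
have sub : {subset x :: p <= take k.-1 (drop (q * k).+1 s)}.
  move=> y py; have : y \in block_kept := allP Sp _ py.
  rewrite inE => /andP[sy ky].
  have lt_y : index y s < size s by rewrite index_mem.
  have yE := divn_eq (index y s) k; rewrite blk // in yE.
  have r_gt0 : 0 < index y s %% k by rewrite lt0n.
  have r_lt : index y s %% k < k by rewrite ltn_mod.
  rewrite -(nth_index y sy); rewrite yE in lt_y *.
  move: (_ %% k) lt_y r_gt0 r_lt => r lt_y r_gt0 r_lt.
  rewrite (_ : q * k + r = (q * k).+1 + r.-1); last lia.
  rewrite -nth_drop -(@nth_take k.-1); last lia.
  apply: mem_nth; rewrite size_take size_drop; case: ifP => _; first lia.
  by rewrite ltn_subRL; apply: leq_trans lt_y; lia.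
apply: leq_ltn_trans (uniq_leq_size up sub) _; rewrite size_take_min.
by apply: leq_ltn_trans (geq_minl _ _) _; rewrite prednK.
Qed.

Lemma card_block_kept :
  1 < k -> k <= size s -> k.-1 * size s <= k.+1 * #|block_kept|.
Proof.
move=> k_gt1 le_k; have /and3P[us _ _] := s_path.
have m_gt0 : 0 < size s by lia.
have k_gt0 : 0 < k by lia.
have [x0 _] : exists x0, x0 \in s.
  by case: s m_gt0 => // x p; exists x; rewrite mem_head.
set c := (size s).-1 %/ k.
pose del := [seq nth x0 s (i * k) | i <- iota 0 c.+1].
have sub : {subset s <= enum block_kept ++ del}.
  move=> x sx; rewrite mem_cat mem_enum inE sx /=.
  have [dvd|//] := boolP (k %| index x s); apply/mapP.
  exists (index x s %/ k); last by rewrite divnK ?nth_index.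
  rewrite mem_iota /= add0n ltnS; apply: leq_div2r.
  by rewrite -ltnS prednK // index_mem.
have le_c : k.+1 * c.+1 <= 2 * size s := multiples_bound k_gt1 le_k.
have := uniq_leq_size us sub; rewrite size_cat size_map size_iota -cardE.
move: (size s) le_c => m; nia.
Qed.

End LongestPath.

Lemma degree_in_sub S V x : S \subset V -> degree_in S x <= degree_in V x.
Proof.
move=> /subsetP sub; apply/subset_leq_card/subsetP => y.
by rewrite !inE => /andP[/sub -> ->].
Qed.

(** By induction on [V]: if a longest path has at least [k] vertices, it is a
    component, which is thinned out and removed. *)
Lemma degree2_path_free V :
  1 < k -> {in V, forall x, degree_in V x <= 2} ->
  exists S, [/\ S \subset V, path_free k S & k.-1 * #|V| <= k.+1 * #|S|].
Proof.
move=> k_gt1; have [n] := ubnP #|V|; elim: n V => // n IHn V lt_n degV.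
have [s sP maxs] := longest_path V.
have [lt_k|le_k] := ltnP (size s) k.
  exists V; split=> //; last by apply: leq_mul => //; lia.
  by move=> p /maxs le_p; apply: leq_ltn_trans lt_k.
have /and3P[us _ /allP Vs] := sP.
pose C := [set x in s]; have CV : C \subset V.
  by apply/subsetP => x; rewrite inE; apply: Vs.
have cardC : #|C| = size s by rewrite cardsE; apply/card_uniqP.
have cardV : #|V| = #|C| + #|V :\: C| by rewrite -(cardsID C V) (setIidPr CV).
have [|x|S [SV freeS leS]] := IHn (V :\: C); first lia.
  rewrite inE => /andP[_ Vx].
  exact: leq_trans (degree_in_sub _ (subsetDl _ _)) (degV x Vx).
have BC : block_kept s \subset C.
  by apply/subsetP => x; rewrite !inE => /andP[].
have disj : [disjoint block_kept s & S].
  apply: disjointWl BC _; apply: disjointWr SV _.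
  by rewrite disjoint_sym disjoints_subset subsetDr.
exists (block_kept s :|: S); split.
- by rewrite subUset (subset_trans BC CV) (subset_trans SV (subsetDl _ _)).
- apply: path_freeU freeS; last by apply: (path_free_block_kept degV sP maxs); lia.
  move=> x y; rewrite inE => /andP[sx _] /(subsetP SV); rewrite !inE.
  case/andP => nsy Vy; apply/negP => exy.
  by have [] := longest_path_neighbor degV sP maxs sx Vy exy; rewrite (negPf nsy).
- rewrite cardsU disjoint_setI0 // cards0 subn0 cardV !mulnDr leq_add //.
  by rewrite cardC; apply: (card_block_kept sP).
Qed.

End DegreeTwo.

(** * The bound on the vertex cover *)

(** Each color class of a Lovász decomposition with [r] classes of degree at
    most [2] and [d - r] classes of degree at most [1] is bounded in terms of
    the largest [P_k]-free set; the inequality is the sum of these bounds. *)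
Lemma path_free_bound (G : sgraph) (k d r : nat) :
  2 < k -> r <= d -> max_degree G < 2 * d + r ->
  k.-1 * #|G| <= (d * k.-1 + 2 * r) * (#|G| - psi k G).
Proof.
move=> k_gt2 le_rd ltD.
have sum_r : \sum_(i < d) (i < r : nat) = r.
  rewrite -(subnKC le_rd) big_split_ord /= (eq_bigr (fun=> 1)) => [|i _].
    rewrite sum_nat_const card_ord muln1 big1 ?addn0 // => i _.
    by rewrite ltnNge leq_addr.
  by rewrite ltn_ord.
pose t (i : 'I_d) := 1 + (i < r).
have [|c degc] := @lovasz_decomposition G 'I_d t.
  apply: leq_trans ltD _; rewrite /t.
  under eq_bigr do rewrite -addSn.
  by rewrite big_split /= sum_r sum_nat_const card_ord mulnC.
have class_bound i :
    k.-1 * #|color_class c i| <= (k.-1 + 2 * (i < r)) * (#|G| - psi k G).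
  have degi : {in color_class c i, forall x, degree_in (color_class c i) x <= t i}.
    by move=> x; rewrite inE => /eqP <-.
  have psi_bound (S : {set G}) : path_free k S -> #|S| <= #|G| - psi k G.
    move=> /(psi_path_free (ltnW (ltnW k_gt2))).
    by have : #|S| <= #|G| := max_card _; lia.
  move: degi; rewrite /t; case: (i < r) => degi.
    have [S [_ freeS leS]] := degree2_path_free (ltnW k_gt2) degi.
    apply: leq_trans leS _; rewrite (_ : k.-1 + 2 * true = k.+1); last lia.
    by rewrite leq_mul2l psi_bound ?orbT.
  by rewrite addn0 leq_mul2l psi_bound ?orbT //; apply: path_free_degree1.
have cardG : #|G| = \sum_(i < d) #|color_class c i|.
  rewrite -sum1_card (partition_big c xpredT) //=; apply: eq_bigr => i _.
  by rewrite -sum1_card; apply: eq_bigl => x; rewrite inE.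
rewrite {1}cardG big_distrr /=.
have -> : d * k.-1 + 2 * r = \sum_(i < d) (k.-1 + 2 * (i < r)).
  by rewrite big_split /= sum_nat_const card_ord -big_distrr /= sum_r.
by rewrite big_distrl; apply: leq_sum.
Qed.

Local Open Scope ring_scope.

Theorem theorem13 (k Delta : nat) (G : sgraph)
    (hk : (3 <= k)%N) (hDelta : Delta = 2%N \/ (4 <= Delta)%N)
    (hG : (max_degree G <= Delta)%N) :
  ((2 <= Delta)%N -> ~~ odd Delta ->
     (psi k G)%:R <=
       ((k%:R - 1) * (Delta%:R - 2) + 4) / ((k%:R - 1) * Delta%:R + 4)
         * #|G|%:R :> rat) /\
  ((5 <= Delta)%N -> odd Delta ->
     (psi k G)%:R <=
       ((k%:R - 1) * (Delta%:R - 3) + 8) / ((k%:R - 1) * (Delta%:R - 1) + 8)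
         * #|G|%:R :> rat).
Proof.
have psi_le : (psi k G <= #|G|)%N by apply: max_card.
have kE : k = k.-1.+1 by lia.
(* The previous bound, rewritten for the ratio [psi k G / n]; the numerator and
   denominator are doubled so that [2 * d] can be replaced by [Delta] or
   [Delta - 1]. *)
have ratio d r : (r <= d)%N -> (0 < r)%N -> (Delta < 2 * d + r)%N ->
    (psi k G)%:R <= ((k%:R - 1) * (2 * d%:R - 2) + 4 * r%:R) /
      ((k%:R - 1) * (2 * d%:R) + 4 * r%:R) * #|G|%:R :> rat.
  move=> le_rd r_gt0 ltD.
  have := path_free_bound hk le_rd (leq_ltn_trans hG ltD).
  rewrite -(ler_nat rat) !natrM natrD !natrM natrB //.
  have -> : (k.-1)%:R = k%:R - 1 :> rat by rewrite [in RHS]kE -natr1 addrK.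
  have : 3 <= k%:R :> rat by rewrite (ler_nat _ 3).
  have : 1 <= r%:R :> rat by rewrite (ler_nat _ 1).
  have : 0 <= d%:R :> rat by rewrite ler0n.
  move: (k%:R) (r%:R) (d%:R) (psi k G)%:R (#|G|%:R) => K R D P N D0 R1 K3 le.
  rewrite mulrAC ler_pdivlMr; last nra.
  lra.
split=> Dge parD.
  have DE : 2 * (Delta./2)%:R = Delta%:R :> rat.
    by rewrite -natrM; congr (_%:R); lia.
  have := ratio Delta./2 1%N; rewrite DE mulr1.
  by apply; lia.
have DE : 2 * (Delta./2)%:R = Delta%:R - 1 :> rat.
  by apply: (addIr 1); rewrite subrK -natrM natr1; congr (_%:R); lia.
have := ratio Delta./2 2%N; rewrite DE.
have -> : Delta%:R - 1 - 2 = Delta%:R - 3 :> rat by ring.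
have -> : 4 * 2%:R = 8 :> rat by ring.
by apply; lia.
Qed.
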